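(* Let $\sigma$ be a signature, $\mathcal{A}$ a $\sigma$-structure, $I$ a set and $\mathcal{U}$ an ultrafilter over $I$. If $\mathcal{U}$ has the $\tau_{\mathcal{A}^I/\mathcal{U}}^{+}$-intersection property, then there is an embedding $e:\mathcal{A}^I/\mathcal{U}\hookrightarrow\mathcal{A}^I$.
   Context: Structures may have partial operations. $\mathcal{A}^I$ is the direct power (domain $A^I$, all functions $I\to A$; operations and relations hold/are defined iff they do so at every coordinate), and $\mathcal{A}^I/\mathcal{U}$ is the ultrapower (operations and relations hold/are defined iff they do so on a set of coordinates in $\mathcal{U}$). An embedding is an injective map that preserves constants, preserves operations (if $\mathrm{F}(a_1,\dots,a_n)=b$ in the source then the same holds for the images), and preserves and reflects relations. $\kappa^+$ is the successor cardinal of $\kappa$. Let $\mathcal{M}$ be a $\sigma$-structure with domain $M$ and let $a\in M$; $\mathrm{F}$ and $\mathrm{R}$ range over the function and relation symbols of $\sigma$, and $\mathrm{ar}$ denotes arity. Let $\mathrm{cc}(a)$ be the set of all $b\in M$ such that one of the following holds: $\mathrm{F}^{\mathcal{M}}(c_1,\dots,b,\dots,c_{\mathrm{ar}(\mathrm{F})-1})=a$ for some $\mathrm{F}$ and some $c_i\in M$ ($b$ occurring in some position); $\mathrm{F}^{\mathcal{M}}(c_1,\dots,a,\dots,c_{\mathrm{ar}(\mathrm{F})-1})=b$ for some $\mathrm{F}$ and some $c_i\in M$ ($a$ occurring in some position); or some $\mathrm{R}^{\mathcal{M}}$ holds of a tuple in which $a$ and $b$ occur in two positions. The connected closure $\llbracket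 a\rrbracket$ is $\bigcup_{n<\omega}\mathrm{cc}^n(\{a\})$, where $\mathrm{cc}^0(\{a\})=\{a\}$ and $\mathrm{cc}^{n+1}(\{a\})=\bigcup_{b\in\mathrm{cc}^n(\{a\})}\mathrm{cc}(b)$. Put $$S^{a\downarrow}_{\mathrm{F}}=\{\langle b_1,\dots,b_{\mathrm{ar}(\mathrm{F})}\rangle\in M^{\mathrm{ar}(\mathrm{F})}\mid\mathrm{F}^{\mathcal{M}}(b_1,\dots,b_{\mathrm{ar}(\mathrm{F})})=a\},$$ $$S^{a\uparrow}_{\mathrm{F}}=\{\langle b_1,\dots,b_{\mathrm{ar}(\mathrm{F})}\rangle\in M^{\mathrm{ar}(\mathrm{F})}\mid\mathrm{F}^{\mathcal{M}}(b_1,\dots,a,\dots,b_{\mathrm{ar}(\mathrm{F})-1})=b_{\mathrm{ar}(\mathrm{F})}\},$$ $$S^{a}_{\mathrm{R}}=\{\langle b_1,\dots,b_{\mathrm{ar}(\mathrm{R})-1}\rangle\in M^{\mathrm{ar}(\mathrm{R})-1}\mid\mathrm{R}^{\mathcal{M}}b_1\dots a\dots b_{\mathrm{ar}(\mathrm{R})-1}\},$$ where in the last two sets $a$ is inserted in some position. Let $\tau_a=\sum_{\mathrm{F}\in\sigma}(|S^{a\downarrow}_{\mathrm{F}}|+|S^{a\uparrow}_{\mathrm{F}}|)+\sum_{\mathrm{R}\in\sigma}|S^a_{\mathrm{R}}|$, $\tau_{\llbracket a\rrbracket}=\sum_{b\in\llbracket a\rrbracket}\tau_b$, and $\tau_{\mathcal{M}}=\sup\{\tau_{\llbracket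 a\rrbracket}\mid a\in M\}$. For a cardinal $\kappa$, a family of sets $X$ has the $\kappa$-intersection property if every $Y\subseteq X$ with $|Y|<\kappa$ satisfies $\bigcap Y\neq\varnothing$. *)

(* Defs.v *)
From mathcomp Require Import all_boot all_classical.

Set Implicit Arguments.
Unset Strict Implicit.
Unset Printing Implicit Defensive.

Local Open Scope classical_set_scope.
Local Open Scope card_scope.

(** Cardinals are represented by types, compared through the library order
    [#<=] (existence of an injection) on full sets. Two types stand for the
    same cardinal when they are equipotent. *)

Definition card_lt T U (A : set T) (B : set U) : Prop :=
  A #<= B /\ ~ (B #<= A).

Definition is_card_sup (J : Type) (T : J -> Type) (K : Type) : Prop :=
  (forall j, [set: T j] #<= [set: K]) /\
  (forall L : Type, (forall j, [set: T j] #<= [set: L]) ->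
     [set: K] #<= [set: L]).

Definition is_card_succ (K K' : Type) : Prop :=
  card_lt [set: K] [set: K'] /\
  (forall L : Type, card_lt [set: K] [set: L] -> [set: K'] #<= [set: L]).

Lemma card_leEx T U (A : set T) (B : set U) :
  A #<= B <-> exists f : A -> B, injective f.
Proof.
split=> [/card_leP/injfunPex[f _ finj]|[f finj]].
  by exists f => x y; apply: finj; rewrite inE.
by apply/card_leP/injfunPex; exists f => // x y _ _; apply: finj.
Qed.

Lemma card_le_typeP (A B : Type) :
  [set: A] #<= [set: B] <-> exists f : A -> B, injective f.
Proof.
pose i T (x : T) : [set: T] := SigSub (mem_set (Logic.I : [set: T] x)).
have iK T : injective (@i T) by move=> x y [].
rewrite card_leEx; split=> -[f finj].
- exists (fun x => val (f (i _ x))) => x y xy.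
  exact/(iK A)/finj/val_inj.
- exists (fun x => i _ (f (val x))) => x y /(iK B) xy.
  exact/val_inj/finj.
Qed.

(* Hönig's argument: a maximal set of choice functions that pairwise differ at
   every index projects onto some [A i]. *)
Lemma card_min (J : Type) (j0 : J) (A : J -> Type) :
  exists i, forall j, [set: A i] #<= [set: A j].
Proof.
pose P (S : set (forall j, A j)) :=
  forall f g j, S f -> S g -> f j = g j -> f = g.
have [|S [PS Smax]] := @Zorn_bigcup _ P.
  move=> F FP Ftot f g j [X FX Xf] [Y FY Yg] fg.
  have [XY|YX] := Ftot _ _ FX FY.
  - exact: (FP _ FY f g j (XY _ Xf) Yg fg).
  - exact: (FP _ FX f g j Xf (YX _ Yg) fg).
have [i Si] : exists i, forall x : A i, exists f, S f /\ f i = x.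
  apply: contrapT => noi.
  have hx j : {x : A j | forall f, S f -> f j <> x}.
    apply: cid; apply: contrapT => nox; apply: noi; exists j => x.
    apply: contrapT => nof; apply: nox; exists x => f Sf fx.
    by apply: nof; exists f.
  pose h j := sval (hx j).
  have hS j f : S f -> f j <> h j by move=> /(svalP (hx j)).
  apply: (Smax (S `|` [set h])).
    split; first by move=> f Sf; left.
    by move=> /(_ h (or_intror erefl)) /(hS j0); apply.
  move=> f g j [Sf|->] [Sg|->] //; first exact: PS.
  - by move=> /(hS _ _ Sf).
  - by move=> /esym /(hS _ _ Sg).
exists i => j; apply/card_le_typeP.
pose s x := sval (cid (Si x)).
have sP x : S (s x) /\ s x i = x by exact: (svalP (cid (Si x))).
exists (fun x => s x j) => x y sxy.
have /(congr1 (fun f => f i)) := PS _ _ _ (sP x).1 (sP y).1 sxy.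
by rewrite !(sP _).2.
Qed.

Lemma card_le_type_total (A B : Type) :
  [set: A] #<= [set: B] \/ [set: B] #<= [set: A].
Proof.
have [[] Hmin] := card_min true (fun b : bool => if b then A else B).
- by left; apply: (Hmin false).
- by right; apply: (Hmin true).
Qed.

(* A property of cardinals that some [Z] has and that is closed under
   equipotence has a least instance. *)
Lemma card_least (P : Type -> Prop) (Z : Type) :
  (forall A B, [set: A] #<= [set: B] -> [set: B] #<= [set: A] -> P A -> P B) ->
  P Z ->
  exists K : Type, P K /\ forall L : Type, P L -> [set: K] #<= [set: L].
Proof.
move=> Pe PZ.
have set_le (X : set Z) : [set: X] #<= [set: Z].
  by apply/card_le_typeP; exists val; apply: val_inj.
have PT : P [set: Z].
  apply: (Pe Z) => //; apply/card_le_typeP.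
  by exists (fun z => SigSub (mem_set (Logic.I : [set: Z] z))) => x y [].
have [[X PX] Xmin] :=
  card_min (exist _ setT PT : {X : set Z | P X}) (fun X => sval X).
exists X; split=> // L PL.
have [/card_le_typeP[f finj]|ZL] := card_le_type_total L Z; last first.
  exact: card_le_trans (set_le X) ZL.
pose Y := range f.
have LY : [set: L] #<= [set: Y].
  apply/card_le_typeP.
  have fY x : f x \in Y by rewrite inE; exists x.
  by exists (fun x => SigSub (fY x)) => x y [] /finj.
have YL : [set: Y] #<= [set: L].
  apply/card_le_typeP.
  have fY (y : Y) : exists x, f x = val y.
    by have := valP y; rewrite inE => -[x _ <-]; exists x.
  exists (fun y => sval (cid (fY y))) => x y exy; apply: val_inj.
  by rewrite -(svalP (cid (fY x))) -(svalP (cid (fY y))) exy.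
exact: card_le_trans (Xmin (exist _ Y (Pe _ _ LY YL PL))) YL.
Qed.

Lemma card_sup_exists (J : Type) (T : J -> Type) :
  exists K, is_card_sup T K.
Proof.
apply: (@card_least (fun K => forall j, [set: T j] #<= [set: K]) {j & T j}).
  by move=> A B AB _ TA j; apply: card_le_trans (TA j) AB.
move=> j; apply/card_le_typeP; exists (existT T j).
exact: (@existT_inj2 {classic J} T).
Qed.

Lemma card_succ_exists (K : Type) : exists K', is_card_succ K K'.
Proof.
apply: (@card_least (fun L => card_lt [set: K] [set: L]) (set K)).
  move=> A B AB BA [KA AK]; split; first exact: card_le_trans KA AB.
  by move=> BK; apply: AK; apply: card_le_trans AB BK.
split.
  apply/card_le_typeP; exists (fun x => [set x]) => x y xy.
  by have : [set y] x by rewrite -xy.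
move=> /card_le_typeP[f finj].
pose D := [set x | exists X, f X = x /\ ~ X x].
have nD : ~ D (f D) by move=> DD; have [X [/finj -> ]] := DD; apply.
by apply: (nD); exists D.
Qed.

Definition card_sup (J : Type) (T : J -> Type) : Type :=
  sval (cid (card_sup_exists T)).

Lemma card_supP (J : Type) (T : J -> Type) : is_card_sup T (card_sup T).
Proof. exact: (svalP (cid (card_sup_exists T))). Qed.

Definition card_succ (K : Type) : Type := sval (cid (card_succ_exists K)).

Lemma card_succP (K : Type) : is_card_succ K (card_succ K).
Proof. exact: (svalP (cid (card_succ_exists K))). Qed.

Definition intersection_property (kappa T : Type) (X : set (set T)) : Prop :=
  forall Y : set (set T), Y `<=` X -> card_lt Y [set: kappa] ->
    \bigcap_(A in Y) A !=set0.

Record signature := Signature {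
  const_sym : Type;
  fun_sym : Type;
  fun_ar : fun_sym -> nat;
  rel_sym : Type;
  rel_ar : rel_sym -> nat
}.

(** Arities are arbitrary, 0 included; constants are kept as separate symbols.
    Operations are partial: [fn F x y] reads "F(x) is defined and equals y".
    Constants are total. *)
Record structure (sigma : signature) := Structure {
  dom :> Type;
  cst : const_sym sigma -> dom;
  fn : forall F : fun_sym sigma, ('I_(fun_ar F) -> dom) -> dom -> Prop;
  fn_functional : forall F x y z, @fn F x y -> @fn F x z -> y = z;
  rl : forall R : rel_sym sigma, ('I_(rel_ar R) -> dom) -> Prop
}.

Arguments cst {sigma} s.
Arguments fn {sigma} s F.
Arguments rl {sigma} s R.

Definition embedding (sigma : signature) (M N : structure sigma)
    (e : M -> N) : Prop :=
  [/\ injective e,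
      forall c, e (cst M c) = cst N c,
      forall F x y, fn M F x y -> fn N F (e \o x) (e y) &
      forall R x, rl M R x <-> rl N R (e \o x)].

Section Power.
Variables (sigma : signature) (I : Type) (A : structure sigma).

Let power_fn (F : fun_sym sigma) (x : 'I_(fun_ar F) -> I -> A) (y : I -> A) :=
  forall i, fn A F (x^~ i) (y i).

Let power_functional F x y z : @power_fn F x y -> @power_fn F x z -> y = z.
Proof. by move=> xy xz; apply/funext => i; apply: fn_functional (xz i). Qed.

Definition power : structure sigma := {|
  dom := I -> A;
  cst c := fun=> cst A c;
  fn := power_fn;
  fn_functional := power_functional;
  rl R x := forall i, rl A R (x^~ i)
|}.

End Power.

Section Ultrapower.
Variables (sigma : signature) (I : Type) (A : structure sigma).
Variables (U : set_system I) (UF : UltraFilter U).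

Definition uclass (f : I -> A) : set (I -> A) :=
  [set g | U [set i | f i = g i]].

Definition ultra_dom : Type := range uclass.

Definition ultra_pi (f : I -> A) : ultra_dom :=
  SigSub (mem_set (imageT uclass f)).

(* Asking for some representatives is the same as asking for all of them, since
   arities are finite and [U] is closed under finite intersections. *)
Let ultra_fn (F : fun_sym sigma) (x : 'I_(fun_ar F) -> ultra_dom)
    (y : ultra_dom) :=
  exists f g, [/\ x = (fun k => ultra_pi (f k)), y = ultra_pi g &
    U [set i | fn A F (f^~ i) (g i)]].

Lemma ultra_piP (f g : I -> A) :
  ultra_pi f = ultra_pi g <-> U [set i | f i = g i].
Proof.
split=> [[fg]|Ufg].
  suff : uclass f g by [].
  rewrite fg /uclass /=.
  by apply: filterS filterT => i _.
apply: val_inj => /=; apply/seteqP; split=> h /=; rewrite /uclass /= => Uh.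
- by apply: filterS2 Ufg Uh => i /= -> .
- by apply: filterS2 Ufg Uh => i /= -> .
Qed.

Let ultra_functional F x y z : @ultra_fn F x y -> @ultra_fn F x z -> y = z.
Proof.
move=> [f [g [-> -> Ufg]]] [f' [g' [ff' -> Ufg']]]; apply/ultra_piP.
have Uff' : U [set i | forall k, f k i = f' k i].
  apply: filter_forall => k; apply/ultra_piP.
  exact: (congr1 (fun h => h k) ff').
apply: filterS3 Uff' Ufg Ufg' => i /= ff'i fg fg'.
apply: fn_functional fg _.
by rewrite (_ : f^~ i = f'^~ i) //; apply/funext => k; apply: ff'i.
Qed.

Definition ultrapower : structure sigma := {|
  dom := ultra_dom;
  cst c := ultra_pi (fun=> cst A c);
  fn := ultra_fn;
  fn_functional := ultra_functional;
  rl R x := exists f, x = (fun k => ultra_pi (f k)) /\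
    U [set i | rl A R (f^~ i)]
|}.

End Ultrapower.

Section Tau.
Variables (sigma : signature) (M : structure sigma).

(* [a] at position [p], the entries of [c] elsewhere in order. *)
Definition insert n (p : 'I_n) (a : M) (c : 'I_n.-1 -> M) : 'I_n -> M :=
  fun i => if unlift p i is Some j then c j else a.

Definition cc (a : M) : set M := [set b |
  [\/ exists F p c, fn M F (insert p b c) a,
      exists F p c, fn M F (insert p a c) b |
      exists R x p q, [/\ rl M R x, p != q, x p = a & x q = b]]].

Definition cc_iter (n : nat) (a : M) : set M :=
  iter n (fun X => \bigcup_(b in X) cc b) [set a].

Definition connected_closure (a : M) : set M := \bigcup_n cc_iter n a.

Definition S_down (a : M) (F : fun_sym sigma) : set ('I_(fun_ar F) -> M) :=
  [set b | fn M F b a].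

(* The tuple <b_1, ..., b_n> is encoded as (<b_1, ..., b_{n-1}>, b_n). *)
Definition S_up (a : M) (F : fun_sym sigma) :
    set (('I_(fun_ar F).-1 -> M) * M) :=
  [set b | exists p, fn M F (insert p a b.1) b.2].

Definition S_rel (a : M) (R : rel_sym sigma) : set ('I_(rel_ar R).-1 -> M) :=
  [set b | exists p, rl M R (insert p a b)].

Arguments S_down a F : clear implicits.
Arguments S_up a F : clear implicits.
Arguments S_rel a R : clear implicits.

Definition tau_pt (a : M) : Type :=
  ({F : fun_sym sigma & S_down a F + S_up a F} +
   {R : rel_sym sigma & S_rel a R})%type.

Definition tau_closure (a : M) : Type :=
  {b : connected_closure a & tau_pt (val b)}.

Definition tau : Type := card_sup tau_closure.

End Tau.

Arguments S_down {sigma M} a F.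
Arguments S_up {sigma M} a F.
Arguments S_rel {sigma M} a R.

(* Main.v *)
Require Import Defs.
From mathcomp Require Import all_boot all_classical.

(** The embedding is a section of the quotient map from the power to the
    ultrapower [M]: a choice of representatives. Any section is injective and
    reflects relations, since what holds everywhere holds on a set of [U]; it
    only has to respect constants, operations and (positively) relations.

    Start from any representatives [s a], constant functions for the constants.
    Each instance [F(x) = y] or [R(x)] that is true in [M] holds for the
    representatives on a set of coordinates in [U]. All elements of such an
    instance lie in one connected component, and the instances inside the
    component of [a] are indexed by a set of size [tau_closure a], hence at most
    [tau M]. The intersection property makes [U] closed under intersections of
    that size ([ultra_bigcap]), so all of them hold simultaneously on a set
    [good_component a] in [U], which depends on the component of [a] alone.
    Outside of that set, replace the values of all representatives of the
    component by their values at one fixed coordinate inside it. This changes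
    the representatives only off a set in [U], keeps constant functions
    constant, and makes every true instance hold at every coordinate. *)

Set Implicit Arguments.
Unset Strict Implicit.
Unset Printing Implicit Defensive.

Local Open Scope classical_set_scope.
Local Open Scope card_scope.

(** If the intersection [P] of the family were outside [U], then removing [P]
    from each member would give a family in [U], no larger than the first one,
    with empty intersection. *)
Lemma ultra_bigcap (K I T : Type) (U : set_system I) (UF : UltraFilter U)
    (P : T -> set I) :
  intersection_property (card_succ K) U -> [set: T] #<= [set: K] ->
  (forall t, U (P t)) -> U (\bigcap_t P t).
Proof.
move=> UK TK UP.
have [//|UnP] := in_ultra_setVsetC (\bigcap_t P t) UF.
have [[t0]|T0] := pselect (inhabited T); last first.
  by apply: filterS filterT => i _ t; case: T0.
pose Q t := P t `&` ~` \bigcap_t P t.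
have QK : range Q #<= [set: K] by apply: card_le_trans (card_image_le _ _) TK.
have [[KK' K'K] _] := card_succP K.
have [||i Qi] := UK (range Q).
- by move=> _ [t _ <-]; exact: filterI.
- split; first exact: card_le_trans QK KK'.
  by move=> K'Q; apply: K'K; apply: card_le_trans K'Q QK.
- exfalso; have [_] : Q t0 i by apply: Qi; exists t0.
  by apply=> t _; have [] : Q t i by apply: Qi; exists t.
Qed.

Lemma set_retraction (I : Type) (J : set I) : J !=set0 ->
  exists r : I -> I, (forall i, J (r i)) /\ forall i, J i -> r i = i.
Proof.
move=> [j Jj]; exists (fun i => if pselect (J i) then i else j).
by split=> i; case: pselect.
Qed.

Section Components.
Variables (sigma : signature) (M : structure sigma).
Implicit Types a b c : M.

Lemma insert_lift n (p : 'I_n) (x : 'I_n -> M) :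
  insert p (x p) (x \o lift p) = x.
Proof. by apply/funext => i; rewrite /insert; case: unliftP => [j|] ->. Qed.

Lemma cc_sym a b : cc a b -> cc b a.
Proof.
case=> [[F [p [c h]]]|[F [p [c h]]]|[R [x [p [q [h pq xp xq]]]]]].
- by apply: Or32; exists F, p, c.
- by apply: Or31; exists F, p, c.
- by apply: Or33; exists R, x, q, p; rewrite eq_sym.
Qed.

Lemma connected_closure_refl a : connected_closure a a.
Proof. by exists 0. Qed.

Lemma connected_closure_cc a b c :
  connected_closure a b -> cc b c -> connected_closure a c.
Proof. by move=> [n _ ab] bc; exists n.+1 => //; exists b. Qed.

Lemma connected_closure_trans a b c :
  connected_closure a b -> connected_closure b c -> connected_closure a c.
Proof.
move=> ab [n _]; elim: n c => [c -> //|n IHn c [d /IHn ad dc]].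
exact: connected_closure_cc ad dc.
Qed.

Lemma connected_closure_sym a b :
  connected_closure a b -> connected_closure b a.
Proof.
move=> [n _]; elim: n b => [b ->|n IHn b [c /IHn ca cb]].
  exact: connected_closure_refl.
apply: connected_closure_trans ca.
exact: connected_closure_cc (connected_closure_refl b) (cc_sym cb).
Qed.

Lemma eq_connected_closure a b :
  cc a b -> connected_closure a = connected_closure b.
Proof.
move=> /(connected_closure_cc (connected_closure_refl a)) ab.
apply/seteqP; split=> c; apply: connected_closure_trans => //.
exact: connected_closure_sym.
Qed.

Lemma connected_closure_fn F x y p :
  fn M F x y -> connected_closure (x p) = connected_closure y.
Proof.
move=> Fxy; apply/esym/eq_connected_closure/Or31.
by exists F, p, (x \o lift p); rewrite insert_lift.
Qed.

Lemma connected_closure_rl R x p q :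
  rl M R x -> connected_closure (x p) = connected_closure (x q).
Proof.
move=> Rx; have [->//|pq] := eqVneq p q.
by apply/eq_connected_closure/Or33; exists R, x, p, q.
Qed.

End Components.

Section Representatives.
Variables (sigma : signature) (A : structure sigma) (I : Type).
Variables (U : set_system I) (UF : UltraFilter U).
Local Notation M := (ultrapower A UF).
Local Notation pi := (@ultra_pi sigma I A U).

Lemma ultra_representatives : exists s : M -> I -> A,
  cancel s pi /\ forall c, s (Defs.cst M c) = fun=> Defs.cst A c.
Proof.
suff /choice[s sP] (a : M) : exists f : I -> A,
    pi f = a /\ forall c, Defs.cst M c = a -> f = fun=> Defs.cst A c.
  by exists s; split=> [a|c]; [case: (sP a)|apply: (sP _).2].
have [[c ca]|nc] := pselect (exists c, Defs.cst M c = a).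
  exists (fun=> Defs.cst A c); split=> // d; rewrite -ca => /ultra_piP dc.
  by have [i /= ->] := filter_ex dc.
have [f _ fa] : range (@uclass _ I A U) (val a) by apply/set_mem/valP.
exists f; split; first exact: val_inj.
by move=> c ca; case: nc; exists c.
Qed.

Variable s : M -> I -> A.
Hypothesis sK : cancel s pi.

Lemma representatives_eq n (x : 'I_n -> M) (f : 'I_n -> I -> A) :
  x = (fun k => pi (f k)) -> U [set i | f^~ i = (s \o x)^~ i].
Proof.
move=> xf; have : U [set i | forall k, f k i = s (x k) i].
  by apply: filter_forall => k; apply/ultra_piP; rewrite sK xf.
by apply: filterS => i fx; apply/funext.
Qed.

Lemma representatives_fn F x y :
  fn M F x y -> U [set i | fn A F ((s \o x)^~ i) (s y i)].
Proof.
move=> [f [g [/representatives_eq xf yg Ufg]]].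
have gy : U [set i | g i = s y i] by apply/ultra_piP; rewrite sK.
by apply: filterS3 xf gy Ufg => i /= <- <-.
Qed.

Lemma representatives_rl R x :
  rl M R x <-> U [set i | rl A R ((s \o x)^~ i)].
Proof.
split=> [[f [/representatives_eq xf Uf]]|Ux].
  by apply: filterS2 xf Uf => i /= <-.
by exists (s \o x); split=> //; apply/funext => k /=; rewrite sK.
Qed.

(** An instance [F(x) = y] is charged to its value [y], through [S_down y F].
    An element of [S_rel b R] does not record the position of [b], hence the
    quantification over all positions at which the relation holds. *)
Definition good_coords (b : M) (t : tau_pt b) : set I :=
  match t with
  | inl (existT F (inl x)) => [set i | fn A F ((s \o val x)^~ i) (s b i)]
  | inl (existT F (inr _)) => setT
  | inr (existT R c) => [set i | forall p, rl M R (insert p b (val c)) ->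
      rl A R ((s \o insert p b (val c))^~ i)]
  end.

Lemma ultra_good_coords (b : M) (t : tau_pt b) : U (good_coords t).
Proof.
case: t => [[F [x|y]]|[R c]] /=.
- by apply: representatives_fn; have := valP x; rewrite inE.
- exact: filterT.
- apply: filter_forall => p.
  have [h|h] := pselect (rl M R (insert p b (val c))).
    by apply: filterS ((representatives_rl _).1 h).
  by apply: filterS filterT.
Qed.

Definition good_component (a : M) : set I :=
  \bigcap_(b in connected_closure a) \bigcap_t good_coords (b := b) t.

Lemma ultra_good_component (a : M) :
  intersection_property (card_succ (tau M)) U -> U (good_component a).
Proof.
move=> Utau; pose P (t : tau_closure a) := good_coords (projT2 t).
have /filterS : U (\bigcap_t P t); last apply.
  apply: (ultra_bigcap UF Utau); first exact: (card_supP _).1.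
  by move=> t; apply: ultra_good_coords.
move=> i good b /mem_set ab t _.
exact: (good (existT (fun b => tau_pt (val b)) (SigSub ab) t)).
Qed.

Lemma good_component_fn F x y i :
  fn M F x y -> good_component y i -> fn A F ((s \o x)^~ i) (s y i).
Proof.
move=> Fxy /(_ _ (connected_closure_refl y)) good.
have Sx : x \in S_down y F by rewrite inE.
exact: (good (inl (existT _ F (inl (SigSub Sx))))).
Qed.

Lemma good_component_rl R x p i :
  rl M R x -> good_component (x p) i -> rl A R ((s \o x)^~ i).
Proof.
move=> Rx /(_ _ (connected_closure_refl _)) good.
have Sx : x \o lift p \in S_rel (x p) R.
  by rewrite inE; exists p; rewrite insert_lift.
have /(_ p) := good (inr (existT _ R (SigSub Sx))) Logic.I.
by rewrite /= insert_lift; apply.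
Qed.

Lemma good_component_embedding :
  (forall c, s (Defs.cst M c) = fun=> Defs.cst A c) ->
  (forall a, U (good_component a)) ->
  exists e : M -> power I A, embedding e.
Proof.
move=> sC Ugood.
have /choice[r rP] (J : set I) : exists r : I -> I,
    J !=set0 -> (forall i, J (r i)) /\ forall i, J i -> r i = i.
  have [/set_retraction[r rP]|nJ] := pselect (J !=set0); first by exists r.
  by exists id.
have good0 a : good_component a !=set0 by exact: filter_ex (Ugood a).
have {}rP a := rP _ (good0 a).
(* [r] takes the set of good coordinates, not the element, as its parameter:
   elements of one component are thus moved to the same coordinate. *)
pose e a : power I A := s a \o r (good_component a).
have eK : cancel e pi.
  move=> a; rewrite -[RHS]sK; apply/ultra_piP.
  by apply: filterS (Ugood a) => i /(rP a).2 /= ri; rewrite /e /= ri.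
exists e; split.
- exact: can_inj eK.
- by move=> c; apply/funext => i; rewrite /e /= sC.
- move=> F x y Fxy; suff h i : fn A F ((e \o x)^~ i) (e y i) by exact: h.
  suff -> : (e \o x)^~ i = (s \o x)^~ (r (good_component y) i).
    exact: good_component_fn Fxy ((rP y).1 i).
  apply/funext => k /=.
  by rewrite /e /good_component (connected_closure_fn k Fxy).
- move=> R x; split=> Rx; last first.
    exists (e \o x); split; first by apply/funext => k /=; rewrite eK.
    by apply: filterS filterT => i _; apply: Rx.
  suff h i : rl A R ((e \o x)^~ i) by exact: h.
  have [[p]|n0] := pselect (inhabited 'I_(rel_ar R)).
    suff -> : (e \o x)^~ i = (s \o x)^~ (r (good_component (x p)) i).
      exact: good_component_rl Rx ((rP (x p)).1 i).
    apply/funext => k /=.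
    by rewrite /e /good_component (connected_closure_rl k p Rx).
  (* An instance of arity 0 has no component, but its truth does not depend on
     the coordinate. *)
  have [j] := filter_ex ((representatives_rl _).1 Rx).
  by congr (rl A R); apply/funext => k; case: n0.
Qed.

End Representatives.

Theorem theorem3p6 (sigma : signature) (A : structure sigma) (I : Type)
    (U : set_system I) (UF : UltraFilter U) :
  intersection_property (card_succ (tau (ultrapower A UF))) U ->
  exists e : ultrapower A UF -> power I A, embedding e.
Proof.
move=> Utau; have [s [sK sC]] := ultra_representatives A UF.
apply: (good_component_embedding sK sC) => a.
exact: ultra_good_component.
Qed.
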